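(* Let $\mathcal{G}$ be a generalised quadrangle of order $(s,s^2)$, $s$ odd, and let $P$ be a point of $\mathcal{G}$ such that $\mathcal{G}\setminus P^\perp$ is a partial quadrangle. Suppose $\mathcal{I}$ is a negative intriguing set of the partial quadrangle $\mathcal{G}\setminus P^\perp$ such that $|\mathcal{I}|$ is either $$\frac{s^2(s^2-1)}{2}\quad\text{or}\quad\frac{s^2(s^2+1)}{2}.$$ Then there is a subset $\mathcal{I}^*$ of points of $P^\perp$ such that $\mathcal{I}\cup\mathcal{I}^*$ is a hemisystem of $\mathcal{G}$.
   Context: A generalised quadrangle of order $(s,t)$ is a point-line incidence structure in which two distinct points are on at most one line, every line has $s+1$ points, every point is on $t+1$ lines, and for every point $X$ not on a line $\ell$ there is exactly one point of $\ell$ collinear with $X$; here $s\ge 2$. $P^\perp$ is the set of all points collinear with $P$, including $P$. A hemisystem of $\mathcal{G}$ ($s$ odd) is a set of points meeting every line in exactly $(s+1)/2$ points. $\mathcal{G}\setminus P^\perp$ denotes the geometry whose points are the points of $\mathcal{G}$ not collinear with $P$ and whose lines are the lines of $\mathcal{G}$ not through $P$. It is a partial quadrangle $\mathsf{PQ}(s-1,s^2,s(s-1))$: lines have $s$ points, points are on $s^2+1$ lines, for each non-incident point-line pair at most one point of the line is collinear with the point, and two non-collinear points have exactly $s(s-1)$ points collinear with both. Its point graph has eigenvalues $(s-1)(s^2+1)$ (the valency), $s-1$ and $-s^2+s-1$. A nonempty proper subset $\mathcal{I}$ of the points of a partial quadrangle is an intriguing set with parameters $(h_1',h_2')$ if the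 number of points of $\mathcal{I}$ collinear with and distinct from a point $X$ is $h_1'$ if $X\in\mathcal{I}$ and $h_2'$ if $X\notin\mathcal{I}$. For $\mathcal{G}\setminus P^\perp$ it is negative if $h_1'-h_2'=-s^2+s-1$. *)

(* Defs.v *)
From mathcomp Require Import all_boot all_order all_algebra.

Set Implicit Arguments.
Unset Strict Implicit.
Unset Printing Implicit Defensive.

Record geometry := Geometry {
  point : finType;
  line : finType;
  inc : point -> line -> bool
}.

(* A point lying on some line is collinear with itself. *)
Definition collinear (G : geometry) (X Y : point G) : bool :=
  [exists l : line G, inc X l && inc Y l].

Definition perp (G : geometry) (P : point G) : {set point G} :=
  P |: [set X | collinear P X].

(* In an order (s,t) (resp. in the first two parameters of a partial
   quadrangle), lines have s + 1 points and points are on t + 1 lines. *)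
Definition partial_linear_space (G : geometry) (s t : nat) : Prop :=
  [/\ forall (X Y : point G) (l m : line G), X != Y ->
        inc X l -> inc Y l -> inc X m -> inc Y m -> l = m,
      forall l : line G, #|[set X : point G | inc X l]| = s.+1 &
      forall X : point G, #|[set l : line G | inc X l]| = t.+1].

Definition generalised_quadrangle (G : geometry) (s t : nat) : Prop :=
  partial_linear_space G s t /\
  forall (X : point G) (l : line G), ~~ inc X l ->
    #|[set Y : point G | inc Y l & collinear X Y]| = 1.

Definition partial_quadrangle (G : geometry) (s t mu : nat) : Prop :=
  [/\ partial_linear_space G s t,
      forall (X : point G) (l : line G), ~~ inc X l ->
        #|[set Y : point G | inc Y l & collinear X Y]| <= 1 &
      forall X Y : point G, X != Y -> ~~ collinear X Y ->
        #|[set Z : point G | collinear X Z & collinear Y Z]| = mu].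

Definition minus_perp (G : geometry) (P : point G) : geometry :=
  @Geometry {X : point G | X \notin perp P} {l : line G | ~~ inc P l}
            (fun X l => inc (val X) (val l)).
Arguments minus_perp : clear implicits.

Definition hemisystem (G : geometry) (s : nat) (H : {set point G}) : Prop :=
  forall l : line G, #|[set X in H | inc X l]| = s.+1 %/ 2.

Definition intriguing (G : geometry) (I : {set point G}) (h1 h2 : nat) : Prop :=
  [/\ I != set0, I != setT &
      forall X : point G,
        #|[set Y in I | (Y != X) && collinear X Y]| =
        if X \in I then h1 else h2].

(* - s^2 + s - 1 is the negative eigenvalue of the
   point graph of a PQ(s - 1, s^2, s(s - 1)). *)
Definition negative_intriguing (G : geometry) (s : nat)
    (I : {set point G}) : Prop :=
  exists h1 h2 : nat, intriguing I h1 h2 /\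
    (h1%:Z - h2%:Z = - s%:Z ^+ 2 + s%:Z - 1)%R.

(* Main.v *)
Require Import Defs.
From mathcomp Require Import all_boot all_order all_algebra.
From mathcomp Require Import zify ring.

Set Implicit Arguments.
Unset Strict Implicit.
Unset Printing Implicit Defensive.

Import GRing.Theory Num.Theory.

(** Write [a_l] for the number of points of the intriguing set on a line [l]
    not through [P].  Such a line meets [perp P] in one point, its foot on
    [perp P], and the [s ^ 2] lines off [P] through a common foot [Y] form a
    class.  The theorem follows from two facts about the numbers [a_l].

    They are constant on each class ([meet_const]).  Let [N] be the
    point-line incidence matrix off [perp P], [A] the adjacency matrix
    there, and [M] the incidence of points off [perp P] with the points of
    [perp P] collinear with them.  A triad [P, X, X'] has [s + 1] centres,
    because [X] and [X'] have [s ^ 2 + 1] common neighbours, of which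
    [s * (s - 1)] lie off [perp P].  Hence [N N^T = A + (s ^ 2 + 1) I], and
    [M M^T] is a combination of [I], [N N^T] and the all-one matrix
    ([centresE]).  On the eigenspace of [A] for [- s ^ 2 + s - 1] these
    matrices are [s] and [s ^ 3], so the sum of the squares of the [a_l] and
    that of the class sums are in ratio exactly [s ^ 2]: Cauchy-Schwarz
    holds with equality in every class.

    They differ from [s / 2] by one half ([meet_two_values]).  The sums of
    [1], [a_l] and [a_l ^ 2] over the lines off [P] are determined by the
    size of the set.  Writing [s = 2 e + 1], they give
    [\sum_l (a_l - e) (a_l - e - 1) = 0] exactly for the two sizes of the
    theorem, and no term of this sum is negative as [a_l] is an integer.

    The hemisystem is then obtained by adding those [Y] whose lines off [P]
    carry [e] points, so that every line off [P] has [e + 1].  On a line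
    through [P], counting the given set by the neighbour that each of its
    points has on that line shows that [e + 1] points were added for the
    smaller size and [e] for the larger one; in the latter case [P] itself is
    added as well. *)

(** * Incidence and double counting in a generalised quadrangle *)

Lemma card_sum_bool (T : finType) (p : pred T) : #|[set x | p x]| = \sum_x p x.
Proof. by rewrite -sum1dep_card big_mkcond; apply: eq_bigr => x _; case: (p x). Qed.

Lemma collinear_sym (G : geometry) (X Y : point G) : collinear X Y = collinear Y X.
Proof. by apply: eq_existsb => l; rewrite andbC. Qed.

Lemma inc_collinear (G : geometry) (l : line G) (X Y : point G) :
  inc X l -> inc Y l -> collinear X Y.
Proof. by move=> Xl Yl; apply/existsP; exists l; rewrite Xl. Qed.

(** This is the [(X, Y)] entry of the product of the incidence matrix with its
    transpose.  Unlike collinearity it has a nonzero diagonal, which makes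
    double counts uniform in [X] and [Y]. *)
Definition joins (G : geometry) (X Y : point G) : nat :=
  \sum_l inc X l * inc Y l.

Section Quadrangle.

Variables (G : geometry) (s t : nat).
Hypothesis gq : generalised_quadrangle G s t.

Lemma line_unique (X Y : point G) (l m : line G) :
  X != Y -> inc X l -> inc Y l -> inc X m -> inc Y m -> l = m.
Proof. by case: gq => -[+ _ _] _; apply. Qed.

Lemma sum_inc_point (l : line G) : \sum_X inc X l = s.+1.
Proof. by case: gq => -[_ + _] _ => /(_ l) <-; rewrite card_sum_bool. Qed.

Lemma sum_inc_line (X : point G) : \sum_l inc X l = t.+1.
Proof. by case: gq => -[_ _ +] _ => /(_ X) <-; rewrite card_sum_bool. Qed.

Lemma sum_foot (X : point G) (l : line G) :
  ~~ inc X l -> \sum_(Y | collinear X Y) inc Y l = 1.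
Proof.
case: gq => _ /[apply] <-; rewrite card_sum_bool big_mkcond.
by apply: eq_bigr => Y _; rewrite andbC; case: collinear.
Qed.

Lemma footP (X : point G) (l : line G) : ~~ inc X l ->
  exists Y, [/\ inc Y l, collinear X Y &
    forall Z, inc Z l -> collinear X Z -> Z = Y].
Proof.
case: gq => _ /[apply] /eqP /cards1P [Y eY].
have hY Z : inc Z l && collinear X Z = (Z == Y).
  by have /setP /(_ Z) := eY; rewrite !inE.
exists Y; have := hY Y; rewrite eqxx => /andP[-> ->]; split=> // Z Zl XZ.
by apply/eqP; rewrite -hY Zl.
Qed.

Lemma collinear_refl (X : point G) : collinear X X.
Proof.
case: (pickP (inc X)) => [l Xl|no]; first exact: (inc_collinear Xl Xl).
by have := sum_inc_line X; rewrite big1 // => l _; rewrite no.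
Qed.

Lemma in_perp (P X : point G) : (X \in perp P) = collinear P X.
Proof. by rewrite !inE; case: eqP => [->|//]; rewrite collinear_refl. Qed.

Lemma joins_refl (X : point G) : joins X X = t.+1.
Proof. by rewrite -(sum_inc_line X); apply: eq_bigr => l _; rewrite mulnb andbb. Qed.

Lemma joins_neq (X Y : point G) : X != Y -> joins X Y = collinear X Y.
Proof.
move=> nXY; case: (boolP (collinear X Y)) => [/existsP[l /andP[Xl Yl]]|nc].
  rewrite /joins (bigD1 l) //= Xl Yl big1 // => m nml.
  rewrite mulnb; case: andP => // -[Xm Ym].
  by rewrite (line_unique nXY Xm Ym Xl Yl) eqxx in nml.
rewrite /joins big1 // => l _; rewrite mulnb; case: andP => // -[Xl Yl].
by rewrite (inc_collinear Xl Yl) in nc.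
Qed.

(** Each of the [t + 1] lines through [X] carries one neighbour of [Y]. *)
Lemma sum_common_neighbours (X Y : point G) : ~~ collinear X Y ->
  \sum_Z collinear X Z * collinear Y Z = t.+1.
Proof.
move=> nXY; rewrite -(sum_inc_line X).
transitivity (\sum_Z joins X Z * collinear Y Z).
  apply: eq_bigr => Z _; case: (eqVneq X Z) => [<-|nXZ]; last by rewrite joins_neq.
  by rewrite [collinear Y X]collinear_sym (negbTE nXY) !muln0.
under eq_bigr do rewrite big_distrl.
rewrite exchange_big; apply: eq_bigr => l _ /=.
case Xl: (inc X l); last by rewrite big1.
rewrite -[RHS](sum_foot (X := Y) (l := l)); last first.
  by apply: contra nXY; apply: inc_collinear.
rewrite [RHS]big_mkcond; apply: eq_bigr => Z _; rewrite mul1n.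
by case: collinear; rewrite ?muln1 ?muln0.
Qed.

Lemma no_triangle (X Y Z : point G) (l : line G) : X != Y ->
  inc X l -> inc Y l -> collinear Z X -> collinear Z Y -> inc Z l.
Proof.
move=> nXY Xl Yl ZX ZY; apply: contraNT nXY => /footP[F [_ _ uF]].
by rewrite (uF X) // (uF Y).
Qed.

Variable P : point G.

Lemma off_perp_nin (X : point G) (l : line G) :
  ~~ collinear P X -> inc X l -> ~~ inc P l.
Proof. by move=> nPX Xl; apply: contra nPX => Pl; apply: inc_collinear Xl. Qed.

Lemma sum_inc_off (l : line G) : ~~ inc P l ->
  \sum_(X | ~~ collinear P X) inc X l = s.
Proof.
move=> Pl; have := sum_inc_point l.
by rewrite (bigID (collinear P)) /= sum_foot // add1n => -[].
Qed.

Lemma sum_inc_nin (Y : point G) : collinear P Y -> Y != P ->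
  \sum_(l | ~~ inc P l) inc Y l = t.
Proof.
move=> PY nYP; have := sum_inc_line Y; rewrite (bigID (inc P)) /=.
rewrite -(_ : joins P Y = \sum_(l | inc P l) inc Y l).
  by rewrite joins_neq 1?eq_sym // PY add1n => -[].
by rewrite /joins [RHS]big_mkcond; apply: eq_bigr => l _; case: inc; rewrite ?mul1n.
Qed.

Lemma sum_perp_neq : \sum_(Y | (Y != P)) collinear P Y = s * t.+1.
Proof.
under eq_bigr => Y nYP do rewrite -joins_neq 1?eq_sym //.
rewrite exchange_big -(sum_inc_line P) big_distrr; apply: eq_bigr => l _ /=.
rewrite -big_distrr /=; case Pl: (inc P l); last by rewrite mul0n muln0.
by have := sum_inc_point l; rewrite (bigD1 P) //= Pl add1n => -[->]; lia.
Qed.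

(** The sum over the lines off [P] may be taken foot by foot, since such a line
    has exactly one point in [perp P], and that point is not [P]. *)
Lemma sum_lines_by_foot (f : line G -> nat) :
  \sum_(Y | collinear P Y && (Y != P)) \sum_(l | ~~ inc P l) inc Y l * f l
    = \sum_(l | ~~ inc P l) f l.
Proof.
rewrite exchange_big; apply: eq_bigr => l Pl; rewrite -big_distrl /=.
rewrite -[RHS]mul1n -(sum_foot Pl); congr (_ * _).
rewrite [RHS](bigD1 P) ?collinear_refl //= (negbTE Pl).
by rewrite add0n.
Qed.

Lemma card_lines_off : #|[pred l | ~~ inc P l]| = s * t.+1 * t.
Proof.
rewrite -sum1_card -(sum_lines_by_foot (fun=> 1)) -sum_perp_neq big_distrl /=.
rewrite [RHS](bigID (collinear P)) /= [X in _ = _ + X]big1 ?addn0; last first.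
  by move=> Y /andP[_ /negbTE->].
apply: eq_big => [Y|Y /andP[PY nYP]]; first by rewrite andbC.
by under eq_bigr do rewrite muln1; rewrite sum_inc_nin // PY mul1n.
Qed.

(** The flags off [perp P] are counted both ways: each line off [P] carries
    [s] points off [perp P], and all [t + 1] lines through a point off
    [perp P] avoid [P]. *)
Lemma card_points_off : #|[pred X | ~~ collinear P X]| = s ^ 2 * t.
Proof.
apply/eqP; rewrite -(eqn_pmul2r (ltn0Sn t)); apply/eqP.
transitivity (s * #|[pred l | ~~ inc P l]|); last by rewrite card_lines_off; lia.
rewrite -!sum1_card big_distrl big_distrr /=.
transitivity (\sum_(X | ~~ collinear P X) \sum_(l | ~~ inc P l) inc X l).
  apply: eq_bigr => X PX; rewrite mul1n -(sum_inc_line X) [RHS]big_mkcond.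
  apply: eq_bigr => l _; case Pl: (inc P l) => //=; case Xl: (inc X l) => //.
  by case/negP: PX; apply: inc_collinear Pl Xl.
by rewrite exchange_big; apply: eq_bigr => l Pl; rewrite muln1 sum_inc_off.
Qed.

End Quadrangle.

(** * Sums of squares *)

Definition meet (G : geometry) (J : {set point G}) (l : line G) : nat :=
  \sum_(X in J) inc X l.

Definition centres (G : geometry) (P X Y : point G) : nat :=
  \sum_(Z | collinear P Z) collinear X Z * collinear Y Z.

(** Both sides count the pairs of points of [J] on a common line. *)
Lemma sum_meet_sq (G : geometry) (J : {set point G}) :
  \sum_l meet J l ^ 2 = \sum_(X in J) \sum_(Y in J) joins X Y.
Proof.
under eq_bigr do rewrite -mulnn big_distrlr /=.
by rewrite exchange_big; apply: eq_bigr => X _; rewrite exchange_big.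
Qed.

(** The Lagrange form of the defect in the Cauchy-Schwarz inequality for [f]
    and the constant [1]. *)
Lemma sum_sq_diff (R : comNzRingType) (T : finType) (A : pred T) (f : T -> R) :
  (\sum_(i | A i) \sum_(j | A j) (f i - f j) ^+ 2 =
   2 * ((\sum_(i | A i) 1) * (\sum_(i | A i) f i ^+ 2)
        - (\sum_(i | A i) f i) ^+ 2))%R.
Proof.
rewrite expr2 !big_distrlr /= -sumrB mulr_sumr.
transitivity (\sum_(i | A i) \sum_(j | A j) ((f i ^+ 2 - f j ^+ 2)
    + 2 * (f j ^+ 2 - f i * f j)))%R.
  by apply: eq_bigr => i _; apply: eq_bigr => j _; ring.
have z : (\sum_(i | A i) \sum_(j | A j) (f i ^+ 2 - f j ^+ 2) = 0)%R.
  under eq_bigr do rewrite sumrB.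
  by rewrite sumrB [X in (_ - X)%R]exchange_big /= subrr.
under [LHS]eq_bigr do rewrite big_split /=.
rewrite big_split /= z add0r; apply: eq_bigr => i _.
by rewrite -sumrB mulr_sumr; apply: eq_bigr => j _; ring.
Qed.

(** * Eigenvector sets off [perp P] *)

Section AffineCounting.

Variables (G : geometry) (s : nat) (P : point G).
Hypothesis s_gt0 : 0 < s.
Hypothesis gq : generalised_quadrangle G s (s ^ 2).
Hypothesis triad : forall X Y : point G, ~~ collinear P X -> ~~ collinear P Y ->
  ~~ collinear X Y -> centres P X Y = s.+1.

(** The three cases [X = Y], [X] and [Y] collinear, and neither give [s ^ 2 + 1],
    [1] and [s + 1] centres, against [s ^ 2 + 1], [1] and [0] joining lines.
    For collinear [X] and [Y] the only centre is the foot of [P] on their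
    line. *)
Lemma centresE (X Y : point G) : ~~ collinear P X -> ~~ collinear P Y ->
  centres P X Y + s * joins X Y = s.+1 + (X == Y) * (s ^ 2 * s.+1).
Proof.
move=> PX PY; case: (eqVneq X Y) => [<-|nXY].
  rewrite (joins_refl gq) /centres; under eq_bigr do rewrite mulnb andbb.
  have := sum_common_neighbours gq PX.
  rewrite (_ : \sum_Z _ = \sum_(Z | collinear P Z) collinear X Z) => [->|]; first lia.
  by rewrite [RHS]big_mkcond; apply: eq_bigr => Z _; case: collinear; rewrite ?mul1n.
rewrite (joins_neq gq nXY) addn0; case: (boolP (collinear X Y)) => [|nc]; last first.
  by rewrite muln0 addn0; apply: triad.
case/existsP=> l /andP[Xl Yl]; have Pl := off_perp_nin PX Xl.
rewrite (_ : centres _ _ _ = 1) ?muln1 // -[RHS](sum_foot gq Pl).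
apply: eq_bigr => Z _; rewrite mulnb; congr nat_of_bool.
apply/andP/idP => [[XZ YZ]|Zl]; last by split; apply: inc_collinear Zl.
by apply: (no_triangle gq nXY Xl Yl); rewrite collinear_sym.
Qed.

(* Since the incidence product is [A + (s ^ 2 + 1) I], the eigenvalue
   [- s ^ 2 + s - 1] of [A] becomes the coefficient [s] in [J_joins]. *)
Variables (J : {set point G}) (h : nat).
Hypothesis J_off : forall X, X \in J -> ~~ collinear P X.
Hypothesis J_joins : forall X, ~~ collinear P X ->
  \sum_(Y in J) joins X Y = h + s * (X \in J).

Lemma meet_off (l : line G) : inc P l -> meet J l = 0.
Proof.
move=> Pl; apply: big1 => X /J_off PX; case Xl: (inc X l) => //.
by case/negP: PX; apply: inc_collinear Pl Xl.
Qed.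

Lemma sum_meet_offE (f : nat -> nat) : f 0 = 0 ->
  \sum_(l | ~~ inc P l) f (meet J l) = \sum_l f (meet J l).
Proof.
move=> f0; rewrite [RHS](bigID (inc P)) /= [X in _ = X + _]big1 // => l Pl.
by rewrite meet_off.
Qed.

Lemma sum_meet : \sum_(l | ~~ inc P l) meet J l = #|J| * (s ^ 2).+1.
Proof.
rewrite (sum_meet_offE (f := id)) // exchange_big -sum1_card big_distrl /=.
by apply: eq_bigr => X _; rewrite (sum_inc_line gq) mul1n.
Qed.

(** Summing [J_joins] over all points off [perp P] counts the flags
    on points of [J] with weight [s]. *)
Lemma card_J : #|J| = s * h.
Proof.
have: \sum_(X | ~~ collinear P X) \sum_(Y in J) joins X Y = #|J| * (s * (s ^ 2).+1).
  rewrite exchange_big -sum1_card big_distrl /=; apply: eq_bigr => Y JY.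
  rewrite exchange_big -(sum_inc_line gq Y) big_distrr big_distrr.
  apply: eq_bigr => l _ /=.
  rewrite -big_distrl /= mul1n; case Yl: (inc Y l); last by rewrite !muln0.
  by rewrite (sum_inc_off gq) ?(off_perp_nin (J_off JY)).
under eq_bigr => X PX do rewrite J_joins //.
rewrite big_split /= sum_nat_const -big_distrr /=.
rewrite -[X in s * X](_ : #|J| = _); last first.
  rewrite -sum1_card big_mkcond [RHS]big_mkcond; apply: eq_bigr => X _ /=.
  by case JX: (X \in J); rewrite ?(J_off JX) // if_same.
rewrite (_ : #|_| = s ^ 2 * s ^ 2); last exact: card_points_off gq P.
move=> e; have : s ^ 3 * #|J| = s ^ 3 * (s * h) by lia.
by move/eqP; rewrite eqn_pmul2l ?expn_gt0 ?s_gt0 // => /eqP.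
Qed.

Lemma sum_meet_sq_off : \sum_(l | ~~ inc P l) meet J l ^ 2 = #|J| * (h + s).
Proof.
rewrite (sum_meet_offE (f := fun n => n ^ 2)) // sum_meet_sq.
rewrite -sum_nat_const; apply: eq_bigr => X JX.
by rewrite J_joins ?J_off // JX muln1.
Qed.

Lemma sum_collinear_J (Y : point G) : collinear P Y ->
  \sum_(X in J) collinear X Y = \sum_(l | ~~ inc P l) inc Y l * meet J l.
Proof.
move=> PY; transitivity (\sum_(X in J) joins Y X).
  apply: eq_bigr => X JX; rewrite (joins_neq gq) 1?collinear_sym //.
  by apply: contraTneq PY => ->; apply: J_off.
rewrite exchange_big /= [RHS]big_mkcond; apply: eq_bigr => l _.
by rewrite -big_distrr; case Pl: (inc P l); rewrite //= -/(meet J l) meet_off ?muln0.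
Qed.

(** The left side counts the pairs of points of [J] together with a common
    neighbour in [perp P].  The right side is [s ^ 2] times the sum of the
    squares of the intersection numbers: this is the equality case of
    Cauchy-Schwarz. *)
Lemma sum_collinear_J_sq :
  \sum_(Y | collinear P Y) (\sum_(X in J) collinear X Y) ^ 2 = s ^ 2 * (#|J| * (h + s)).
Proof.
under eq_bigr do rewrite -mulnn big_distrlr /=.
rewrite exchange_big; under eq_bigr do rewrite exchange_big /=.
rewrite (eq_bigr (fun X => \sum_(Y in J) centres P X Y)) //.
have : \sum_(X in J) \sum_(Y in J) (centres P X Y + s * joins X Y) =
       #|J| * (#|J| * s.+1 + s ^ 2 * s.+1).
  rewrite -sum_nat_const; apply: eq_bigr => X JX.
  under eq_bigr => Y JY do rewrite centresE ?J_off //.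
  rewrite big_split /= sum_nat_const -big_distrl /=; congr (_ + _).
  rewrite (bigD1 X) //= eqxx big1 ?mul1n // => Y /andP[_ /negbTE].
  by rewrite eq_sym => ->.
under eq_bigr => X JX do rewrite big_split /= -big_distrr /= J_joins ?J_off // JX muln1.
rewrite big_split /= sum_nat_const card_J; lia.
Qed.

Local Open Scope ring_scope.

(** For each [Y], the pairwise squared differences over the class of [Y] add up
    to twice [s ^ 2 \sum a_l ^ 2 - (\sum a_l) ^ 2].  Summed over all [Y] this
    is zero, so every difference vanishes. *)
Lemma meet_const (Y : point G) (l m : line G) : collinear P Y -> Y != P ->
  ~~ inc P l -> ~~ inc P m -> inc Y l -> inc Y m -> meet J l = meet J m.
Proof.
pose A Y := [pred l | ~~ inc P l && inc Y l].
pose f l : int := (meet J l)%:R.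
pose V Y := \sum_(l | A Y l) \sum_(m | A Y m) (f l - f m) ^+ 2.
move=> PY nYP Pl Pm Yl Ym.
have sumA Z (g : line G -> nat) : \sum_(l | A Z l) (g l)%:R
    = (\sum_(l | ~~ inc P l) inc Z l * g l)%N%:R :> int.
  rewrite natr_sum [RHS](bigID (inc Z)) /= [X in _ = _ + X]big1 ?addr0.
    by apply: eq_bigr => i /andP[_ ->]; rewrite mul1n.
  by move=> i /andP[_ /negbTE->].
have V0 : \sum_(Z | collinear P Z && (Z != P)) V Z = 0.
  have VE Z : collinear P Z && (Z != P) -> V Z = 2 * ((s ^ 2)%:R *
      (\sum_(l | ~~ inc P l) inc Z l * meet J l ^ 2)%N%:R
      - ((\sum_(X in J) collinear X Z) ^ 2)%N%:R).
    case/andP=> PZ nZP; rewrite /V sum_sq_diff sum_collinear_J //.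
    rewrite [X in _ = _ * (_ - X)]natrX -!sumA; congr (_ * (_ * _ - _)).
      rewrite (sumA Z (fun=> 1%N)) -(sum_inc_nin gq PZ nZP); congr _%:R.
      by apply: eq_bigr => i _; rewrite muln1.
    by apply: eq_bigr => i _; rewrite natrX.
  rewrite (eq_bigr _ VE) -mulr_sumr sumrB -mulr_sumr -!natr_sum.
  rewrite (sum_lines_by_foot gq) sum_meet_sq_off.
  have := sum_collinear_J_sq.
  rewrite (bigD1 P) ?(collinear_refl gq) //= [X in (X ^ 2 + _)%N]big1 ?add0n.
    by move=> ->; rewrite -natrM subrr mulr0.
  by move=> X /J_off; rewrite collinear_sym => /negbTE->.
have pos Z : collinear P Z && (Z != P) -> 0 <= V Z.
  by move=> _; apply: sumr_ge0 => i _; apply: sumr_ge0 => j _; apply: sqr_ge0.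
have sq_ge0 l' m' : 0 <= (f l' - f m') ^+ 2 by apply: sqr_ge0.
have VY : V Y = 0 by apply: (psumr_eq0P pos V0); rewrite PY.
have Vl : \sum_(m | A Y m) (f l - f m) ^+ 2 = 0.
  by apply: (psumr_eq0P _ VY) => [l' _|]; [apply: sumr_ge0 | rewrite /= Pl].
have /eqP : (f l - f m) ^+ 2 = 0 by apply: (psumr_eq0P _ Vl); rewrite //= Pm.
by rewrite sqrf_eq0 subr_eq0 eqr_nat => /eqP.
Qed.

(** * The two exceptional sizes *)

(* As [card_J] makes the size of the set [s * h], the sizes
   [s ^ 2 * (s ^ 2 + d) / 2] correspond to [h_eq]. *)
Variables (e : nat) (d : int).
Hypothesis s_odd : s = (2 * e).+1.
Hypothesis d_sign : d ^+ 2 = 1.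
Hypothesis h_eq : 2 * h%:Z = s%:Z * (s%:Z ^+ 2 + d).

(** Four times [\sum_l (a_l - e) (a_l - e - 1)] is [s ^ 3 * (d ^ 2 - 1)]. *)
Lemma meet_two_values (l : line G) : ~~ inc P l -> meet J l = e \/ meet J l = e.+1.
Proof.
have sE : s%:Z = 2 * e%:Z + 1 by rewrite s_odd; lia.
pose g l : int := ((meet J l)%:Z - e%:Z) * ((meet J l)%:Z - e%:Z - 1).
have g_ge0 m : 0 <= g m 
  by rewrite /g; case: (leqP (meet J m) e) => ?;
    [apply: mulr_le0 | apply: mulr_ge0]; lia.
have g0 : \sum_(m | ~~ inc P m) g m = 0.
  have -> : \sum_(m | ~~ inc P m) g m =
    (\sum_(m | ~~ inc P m) meet J m ^ 2)%N%:R
    - s%:Z * (\sum_(m | ~~ inc P m) meet J m)%N%:R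
    + e%:Z * (e%:Z + 1) * #|[pred m | ~~ inc P m]|%:R.
    rewrite -sum1_card !natr_sum !mulr_sumr -sumrB -big_split /=.
    by apply: eq_bigr => m _; rewrite /g sE natrX !natz; ring.
  rewrite sum_meet_sq_off sum_meet (card_lines_off gq) card_J !natz.
  (* Multiplying by four lets [2 * h] and [4 * e * (e + 1) = s ^ 2 - 1] be
     substituted without division. *)
  apply: (@mulfI _ 4) => //; rewrite mulr0.
  transitivity (s%:Z * (2 * h%:Z) * (2 * h%:Z + 2 * s%:Z)
    - 2 * s%:Z ^+ 2 * (s%:Z ^+ 2 + 1) * (2 * h%:Z)
    + (s%:Z ^+ 2 - 1) * s%:Z ^+ 3 * (s%:Z ^+ 2 + 1)).
    have -> : s%:Z ^+ 2 - 1 = 4 * (e%:Z * (e%:Z + 1)) by rewrite sE; ring.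
    by rewrite -(addn1 (s ^ 2)) expnS expn1 !(PoszM, PoszD); ring.
  rewrite h_eq.
  transitivity (s%:Z ^+ 3 * (d ^+ 2 - 1)); first by ring.
  by rewrite d_sign subrr mulr0.
move=> Pl; have : g l = 0 by apply: (psumr_eq0P _ g0).
by rewrite /g => /eqP; rewrite mulf_eq0 => /orP[] /eqP; lia.
Qed.


(** * Completion to a hemisystem *)

Local Close Scope ring_scope.

Variable b : bool.
Hypothesis d_eq : d = (if b then 1 else -1)%R.

Definition completion : {set point G} :=
  [set Y | collinear P Y &
     if Y == P then b else [exists l, [&& ~~ inc P l, inc Y l & meet J l == e]]].

(** The line chosen in the definition is immaterial by [meet_const]. *)
Lemma mem_completion (Y : point G) (l : line G) : collinear P Y -> Y != P ->
  ~~ inc P l -> inc Y l -> (Y \in completion) = (meet J l == e).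
Proof.
move=> PY nYP Pl Yl; rewrite inE PY (negbTE nYP) /=.
apply/existsP/idP => [[m /and3P[Pm Ym /eqP <-]]|el].
  by rewrite (meet_const PY nYP Pl Pm Yl Ym).
by exists l; rewrite Pl Yl.
Qed.

Lemma card_union_on_line (l : line G) :
  #|[set X in J :|: completion | inc X l]|
    = meet J l + \sum_X (X \in completion) * inc X l.
Proof.
rewrite card_sum_bool /meet [X in _ = X + _]big_mkcond -big_split /=.
apply: eq_bigr => X _; rewrite inE; case JX: (X \in J) => /=.
  by rewrite [X \in completion]inE (negbTE (J_off JX)) mul0n addn0.
by rewrite mulnb add0n.
Qed.

(** Each of the [s ^ 2] lines off [P] through [Y] carries [e] points of [J] if
    [Y] was added and [e + 1] otherwise. *)
Lemma sum_collinear_J_completion (Y : point G) : collinear P Y -> Y != P ->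
  \sum_(X in J) collinear X Y + s ^ 2 * (Y \in completion) = s ^ 2 * e.+1.
Proof.
move=> PY nYP; rewrite sum_collinear_J // -(sum_inc_nin gq PY nYP) !big_distrl /=.
rewrite -big_split /=; apply: eq_bigr => l Pl; case Yl: (inc Y l); last by [].
rewrite (mem_completion PY nYP Pl Yl) !mul1n.
by case: (meet_two_values Pl) => ->; lia.
Qed.

(** Every point of [J] has exactly one neighbour on a line [l] through [P], and
    it is not [P].  Adding up [sum_collinear_J_completion] over [l] gives
    [#|J| + s ^ 2 * N = s ^ 3 * (e + 1)] for the number [N] of added points
    other than [P], that is [2 * N = s - d]. *)
Lemma card_completion_on_line (l : line G) : inc P l ->
  \sum_(Y | Y != P) (Y \in completion) * inc Y l + b = e.+1.
Proof.
move=> Pl; set N := \sum_(Y | _) _.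
have on Y : inc Y l -> collinear P Y by apply: inc_collinear.
have cJ : #|J| = \sum_(Y | Y != P) inc Y l * \sum_(X in J) collinear X Y.
  transitivity (\sum_(X in J) \sum_(Y | collinear X Y) inc Y l).
    rewrite -sum1_card; apply: eq_bigr => X /J_off PX; rewrite (sum_foot gq) //.
    by apply: contra PX; apply: on.
  under eq_bigr do rewrite big_mkcond.
  rewrite exchange_big [LHS](bigD1 P) //= big1 ?add0n => [|X /J_off].
    apply: eq_bigr => Y _; rewrite big_distrr; apply: eq_bigr => X _ /=.
    by case: collinear; rewrite ?muln1 ?muln0.
  by rewrite collinear_sym => /negbTE->.
have sl : \sum_(Y | Y != P) inc Y l = s.
  by have := sum_inc_point gq l; rewrite (bigD1 P) //= Pl add1n => -[].
have : #|J| + s ^ 2 * N = s * (s ^ 2 * e.+1).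
  rewrite cJ -[X in X * (_ * e.+1)]sl big_distrl big_distrr -big_split /=.
  apply: eq_bigr => Y nYP; case Yl: (inc Y l); last by rewrite !muln0.
  by rewrite !mul1n muln1 sum_collinear_J_completion // on.
rewrite card_J => eN; clearbody N; clear - eN h_eq s_odd d_eq s_gt0.
have eZ : (s%:Z ^+ 2 * (s%:Z ^+ 2 + d + 2 * N%:Z) = s%:Z ^+ 2 * (s%:Z * (s%:Z + 1)))%R.
  have sE : (s%:Z + 1 = 2 * e.+1%:Z)%R by rewrite s_odd; lia.
  have : (s%:Z * h%:Z + s%:Z ^+ 2 * N%:Z = s%:Z * (s%:Z ^+ 2 * e.+1%:Z))%R.
    by move: eN => /(congr1 Posz); rewrite expnS expn1 !(PoszM, PoszD) !expr2.
  rewrite sE => eN'.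
  transitivity (s%:Z * (s%:Z * (s%:Z ^+ 2 + d)) + 2 * (s%:Z ^+ 2 * N%:Z))%R;
    first by ring.
  rewrite -h_eq.
  transitivity (2 * (s%:Z * h%:Z + s%:Z ^+ 2 * N%:Z))%R;
    first by ring.
  by rewrite eN'; ring.
have {eZ} : (s%:Z ^+ 2 + d + 2 * N%:Z = s%:Z * (s%:Z + 1))%R.
  by apply: mulfI eZ; rewrite expf_neq0 //; lia.
rewrite mulrDr mulr1 -expr2 => eZ.
have : (d + 2 * N%:Z = s%:Z)%R by apply: (addrI (s%:Z ^+ 2)%R); rewrite addrA.
by rewrite d_eq s_odd; case: (b); lia.
Qed.

Lemma hemisystem_completion : hemisystem s (J :|: completion).
Proof.
move=> l; have -> : s.+1 %/ 2 = e.+1 by rewrite s_odd; lia.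
rewrite card_union_on_line; case Pl: (inc P l).
  rewrite meet_off // (bigD1 P) //= -(card_completion_on_line Pl).
  by rewrite [P \in _]inE (collinear_refl gq) eqxx Pl muln1 add0n addnC.
move/negbT: Pl => Pl; have [F [Fl PF uF]] := footP gq Pl.
have nFP : F != P by apply: contraNneq Pl => <-.
rewrite (bigD1 F) //= big1 => [|X nXF].
  rewrite (mem_completion PF nFP Pl Fl) Fl.
  by case: (meet_two_values Pl) => ->; lia.
case Xl: (inc X l); rewrite ?muln0 //.
case: (boolP (X \in completion)) => // /[!inE] /andP[PX _].
by rewrite (uF X Xl PX) eqxx in nXF.
Qed.

End AffineCounting.

(** * From the partial quadrangle to the ambient quadrangle *)

(** A line through a point outside [perp P] cannot contain [P]. *)
Lemma collinear_minus_perp (G : geometry) (s t : nat) (P : point G) :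
  generalised_quadrangle G s t -> forall X Y : point (minus_perp G P),
  collinear X Y = collinear (val X) (val Y).
Proof.
move=> gq X Y; apply/existsP/existsP => -[l]; first by exists (val l).
case/andP=> Xl Yl.
have Pl : ~~ inc P l.
  by apply: off_perp_nin Xl; rewrite -(in_perp gq); apply: (valP X).
by exists (exist _ l Pl); rewrite /= Xl.
Qed.

Lemma sum_minus_perp (G : geometry) (P : point G) (f : point G -> nat) :
  \sum_(X : point (minus_perp G P)) f (val X) = \sum_(X | X \notin perp P) f X.
Proof.
by rewrite [RHS](big_sub [pred X | X \notin perp P]).
Qed.

Theorem theorem5p4 (G : geometry) (s : nat) (P : point G)
    (I : {set point (minus_perp G P)}) :
  1 < s -> odd s ->
  generalised_quadrangle G s (s ^ 2) ->
  partial_quadrangle (minus_perp G P) (s - 1) (s ^ 2) (s * (s - 1)) ->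
  negative_intriguing s I ->
  #|I| = (s ^ 2 * (s ^ 2 - 1)) %/ 2 \/ #|I| = (s ^ 2 * (s ^ 2 + 1)) %/ 2 ->
  exists Istar : {set point G},
    Istar \subset perp P /\
    hemisystem s ((val @: I) :|: Istar).
Proof.
move=> s_gt1 s_odd gq [_ _ mu] [h1 [h2 [[_ _ Ih] h12]]] cI.
have s_gt0 : 0 < s by apply: ltnW.
have colE := collinear_minus_perp gq.
set J := val @: I.
have sumJ (f : point G -> nat) : \sum_(X in J) f X = \sum_(X in I) f (val X).
  by rewrite big_imset // => ? ? _ _; apply: val_inj.
have cJI : #|J| = #|I| by apply: card_imset; apply: val_inj.
have off X : ~~ collinear P X -> exists X' : point (minus_perp G P), X = val X'.
  by rewrite -(in_perp gq) => PX; exists (exist _ X PX).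
have J_off X : X \in J -> ~~ collinear P X.
  by case/imsetP=> X' _ ->; rewrite -(in_perp gq); apply: (valP X').
(* [X] and [Y] have [s ^ 2 + 1] common neighbours, [s * (s - 1)] of them outside
   [perp P]. *)
have triad X Y : ~~ collinear P X -> ~~ collinear P Y -> ~~ collinear X Y ->
    centres P X Y = s.+1.
  move=> PX PY XY; have := sum_common_neighbours gq XY.
  rewrite (bigID (collinear P)) /= -/(centres P X Y).
  rewrite -(eq_bigl _ _ (fun Z => congr1 negb (in_perp gq P Z))).
  rewrite -sum_minus_perp; case: (off X PX) XY => X' ->; case: (off Y PY) => Y' ->.
  rewrite -colE => XY.
  have nXY : X' != Y'.
    by apply: contraNneq XY => ->; rewrite colE (collinear_refl gq).
  have := mu X' Y' nXY XY; rewrite card_sum_bool.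
  rewrite (eq_bigr (fun Z => collinear (val X') (val Z) * collinear (val Y') (val Z))).
    by move=> ->; nia.
  by move=> Z _; rewrite !colE mulnb.
(* The joining lines are counted by the neighbours of [X] in the set, plus the
   [s ^ 2 + 1] lines on [X] itself when [X] belongs to it. *)
have J_joins X : ~~ collinear P X ->
    \sum_(Y in J) joins X Y = h2 + s * (X \in J).
  case/off=> X' ->; rewrite sumJ (mem_imset _ _ val_inj).
  have nI : \sum_(Y in I | Y != X') joins (val X') (val Y)
      = if X' \in I then h1 else h2.
    rewrite -Ih card_sum_bool big_mkcond; apply: eq_bigr => Y _.
    case: (Y \in I) => //=; case: eqVneq => //= nYX.
    by rewrite (joins_neq gq) ?colE // eq_sym (inj_eq val_inj).
  case: ifP nI => IX nI.
    by rewrite (bigD1 X') //= nI (joins_refl gq); lia.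
  rewrite muln0 addn0 -nI; apply: eq_bigl => Y.
  by case: eqVneq => [->|]; rewrite ?IX ?andbT.
have cJ := card_J s_gt0 gq J_off J_joins.
have sE : s = (2 * s./2).+1 by lia.
suff [b hb] : exists b : bool,
    (2 * h2%:Z = s%:Z * (s%:Z ^+ 2 + (if b then 1 else -1)))%R.
  exists (completion P J s./2 b); split.
    by apply/subsetP => X; rewrite (in_perp gq) inE => /andP[].
  have d2 : (((if b then 1 else -1) : int) ^+ 2 = 1)%R by case: (b).
  exact: (hemisystem_completion s_gt0 gq triad J_off J_joins sE d2 hb erefl).
have half (n : nat) : ~~ odd n -> 2 * (n %/ 2) = n.
  by move=> ?; rewrite divn2 mul2n halfK; lia.
have cZ : (s%:Z * (2 * h2%:Z) = (2 * #|I|)%N%:Z)%R.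
  by rewrite -cJI cJ !PoszM; ring.
have fold (d : int) : ((2 * #|I|)%N%:Z = s%:Z ^+ 2 * (s%:Z ^+ 2 + d))%R ->
    (2 * h2%:Z = s%:Z * (s%:Z ^+ 2 + d))%R.
  move=> e; apply: (@mulfI _ s%:Z); first by lia.
  by rewrite cZ e mulrA.
have s2 : ((s ^ 2)%N%:Z = s%:Z ^+ 2)%R by rewrite -mulnn PoszM expr2.
case: cI => cI; [exists false | exists true]; apply: fold; rewrite cI half.
- by rewrite PoszM -subzn ?expn_gt0 ?s_gt0 // s2.
- by rewrite oddM oddB ?oddX ?s_odd ?orbT // expn_gt0 s_gt0.
- by rewrite PoszM PoszD s2.
- by rewrite oddM oddD oddX s_odd orbT.
Qed.
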